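(* Algorithm OptGrp (described in the context) returns an optimal answer for the problem Grp: on every instance that has a feasible group, OptGrp returns a feasible group $\mathcal{G}$ whose diameter $\mathrm{DiaDist}(\mathcal{G})$ is minimum among all feasible groups.
   Context: **Problem Grp.** An instance consists of a finite worker set $\mathcal{U}=\{u_1,\dots,u_n\}$; skill domains $d_1,\dots,d_m$; skills $u_{d_i}\in[0,1]$ and wages $w_u\in[0,1]$ for every worker $u$; a symmetric distance $\mathrm{dist}(u,v)\in[0,1]$ on workers with $\mathrm{dist}(u,u)=0$; skill thresholds $Q_1,\dots,Q_m\ge0$; and a cost budget $C\ge0$. A group $\mathcal{G}\subseteq\mathcal{U}$ is feasible if $\sum_{u\in\mathcal{G}}u_{d_i}\ge Q_i$ for all $i$ and $\sum_{u\in\mathcal{G}}w_u\le C$. The goal is to find a feasible group minimizing $\mathrm{DiaDist}(\mathcal{G})=\max_{u,v\in\mathcal{G}}\mathrm{dist}(u,v)$. **Subroutine GrpCandidateSet (returning all valid answers).** Fix an arbitrary order of the workers. Consider the binary decision tree in which, level by level, each worker in this order is either included in the group (edge label $1$) or excluded (edge label $0$), so that root-to-leaf paths correspond to worker groups. The tree is explored depth-first. At each node, let $S$ be the set of workers included so far and $R$ the set of workers not yet decided. Compute $LB_C=\sum_{u\in S}w_u$ and, for each $i$, $UB_{d_i}=\sum_{u\in S\cup R}u_{d_i}$. If $LB_C>C$, or $UB_{d_i}<Q_i$ for some $i$, the whole subtree below the node is pruned; otherwise the exploration continues. The subroutine returns all groups corresponding to leaves that are reached and not pruned. **Algorithm OptGrp.**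 It calls this subroutine on the full worker set $\mathcal{U}$ and outputs, among all returned groups, one with the smallest diameter, i.e. whose largest pairwise distance is smallest. *)

(* Defs.v *)
From HB Require Import structures.
From mathcomp Require Import all_boot all_order all_algebra.

Set Implicit Arguments.
Unset Strict Implicit.
Unset Printing Implicit Defensive.

Import Order.TTheory GRing.Theory Num.Theory.
Local Open Scope ring_scope.

Record grp_instance (R : realFieldType) (U : finType) (m : nat) := GrpInstance {
  skill : U -> 'I_m -> R;
  wage : U -> R;
  dist : U -> U -> R;
  threshold : 'I_m -> R;
  budget : R;
  skill_01 : forall u i, 0 <= skill u i <= 1;
  wage_01 : forall u, 0 <= wage u <= 1;
  dist_01 : forall u v, 0 <= dist u v <= 1;
  dist_sym : forall u v, dist u v = dist v u;
  dist_refl : forall u, dist u u = 0;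
  threshold_ge0 : forall i, 0 <= threshold i;
  budget_ge0 : 0 <= budget
}.

Section Grp.
Variables (R : realFieldType) (U : finType) (m : nat) (I : grp_instance R U m).

Definition feasible (G : {set U}) : Prop :=
  (forall i : 'I_m, threshold I i <= \sum_(u in G) skill I u i)
  /\ \sum_(u in G) wage I u <= budget I.

(* Distances are nonnegative, so the unit 0 does not affect the maximum when G
   is nonempty; the empty group is given diameter 0. *)
Definition DiaDist (G : {set U}) : R :=
  \big[Num.max/0]_(u in G) \big[Num.max/0]_(v in G) dist I u v.

Definition optimal (G : {set U}) : Prop :=
  feasible G /\ forall H : {set U}, feasible H -> DiaDist G <= DiaDist H.

Definition LB_C (S : {set U}) : R := \sum_(u in S) wage I u.

Definition UB_d (S : {set U}) (rest : seq U) (i : 'I_m) : R :=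
  \sum_(u in S :|: [set u in rest]) skill I u i.

Definition pruned (S : {set U}) (rest : seq U) : bool :=
  (budget I < LB_C S) || [exists i, UB_d S rest i < threshold I i].

(* A node of the decision tree is the pair of the set S of workers included so
   far and the sequence rest of undecided workers, the next one to decide at
   its head; leaves have rest = [::] and are themselves subject to pruning. *)
Fixpoint explore (S : {set U}) (rest : seq U) : seq {set U} :=
  if pruned S rest then [::]
  else if rest is u :: rest' then explore (u |: S) rest' ++ explore S rest'
  else [:: S].

Definition GrpCandidateSet (order : seq U) : seq {set U} := explore set0 order.

(* A relation rather than a function, so as not to fix how ties between
   candidates of equal diameter are broken. *)
Definition OptGrp_returns (order : seq U) (G : {set U}) : Prop :=
  G \in GrpCandidateSet order
  /\ forall H : {set U}, H \in GrpCandidateSet order -> DiaDist G <= DiaDist H.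

End Grp.

(* Main.v *)
(* Nonnegativity of wages and skills makes LB_C a lower bound on the cost, and
   UB_d an upper bound on the skills, of every group below a node.  So pruning
   never cuts a feasible group; at a leaf both bounds are exact, so the
   surviving leaves are precisely the feasible groups. *)
Require Import Defs.
From mathcomp Require Import all_boot all_order all_algebra.

Import Order.TTheory GRing.Theory Num.Theory.
Local Open Scope ring_scope.

Lemma ler_sum_subset (R : realFieldType) (T : finType) (A B : {set T})
    (F : T -> R) :
  (forall x, 0 <= F x) -> A \subset B ->
  \sum_(x in A) F x <= \sum_(x in B) F x.
Proof.
move=> F_ge0 sAB; rewrite [leRHS](big_setID A) /= (setIidPr sAB) lerDl.
exact: sumr_ge0.
Qed.

Section Exploration.
Set Implicit Arguments.
Unset Strict Implicit.
Context {R : realFieldType} {U : finType} {m : nat} (I : grp_instance R U m).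
Implicit Types (S G : {set U}) (rest : seq U).

Lemma pruned_leafP S : reflect (feasible I S) (~~ pruned I S [::]).
Proof.
have UBE i : UB_d I S [::] i = \sum_(u in S) skill I u i.
  by rewrite /UB_d (_ : [set u in [::]] = set0) ?setU0 //; apply/setP=> u; rewrite !inE.
apply: (iffP idP) => [|[skillG wageG]].
  rewrite negb_or -leNgt => /andP[wageG /existsPn skillG]; split=> // i.
  by rewrite -UBE leNgt.
rewrite negb_or -leNgt; apply/andP; split=> //.
by apply/existsPn=> i; rewrite UBE -leNgt.
Qed.

(** The two inclusions say that the leaf of [G] lies below the node [(S, rest)]: [G] contains all
    included workers and otherwise only undecided ones. Sums of nonnegative terms are monotone along
    these inclusions. *)
Lemma feasible_not_pruned S rest G :
  feasible I G -> S \subset G -> G \subset S :|: [set u in rest] ->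
  ~~ pruned I S rest.
Proof.
move=> [skillG wageG] sSG sGSr; rewrite negb_or -leNgt; apply/andP; split.
  apply: le_trans wageG; apply: ler_sum_subset sSG => u.
  by case/andP: (wage_01 I u).
apply/existsPn=> i; rewrite -leNgt; apply: le_trans (skillG i) _.
apply: ler_sum_subset sGSr => u.
by case/andP: (skill_01 I u i).
Qed.

(** Only the test at the leaf matters, so the induction needs no invariant relating [S] and
    [rest]. *)
Lemma explore_feasible S rest G : G \in explore I S rest -> feasible I G.
Proof.
elim: rest S => [|u rest IH] S /=; case: ifPn => // unpruned.
  by rewrite inE => /eqP->; apply/pruned_leafP.
by rewrite mem_cat => /orP[] /IH.
Qed.

(** Induction down the path that includes a worker exactly when it belongs to [G]; both inclusions
    are preserved, so no node on this path is pruned. *)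
Lemma feasible_explore S rest G :
  feasible I G -> S \subset G -> G \subset S :|: [set u in rest] ->
  G \in explore I S rest.
Proof.
move=> feasG; elim: rest S => [|u rest IH] S sSG sGSr /=;
  rewrite (negPf (feasible_not_pruned feasG sSG sGSr)).
  (* With nobody left undecided, the two inclusions force [G = S]. *)
  rewrite inE eqEsubset sSG andbT; apply: subset_trans sGSr _.
  by apply/subsetP=> v; rewrite !inE orbF.
rewrite mem_cat; apply/orP; case: (boolP (u \in G)) => uG.
  left; apply: IH; first by rewrite subUset sub1set uG.
  by apply: subset_trans sGSr _; apply/subsetP=> v; rewrite !inE orbCA orbA.
right; apply: IH => //; apply/subsetP=> v vG.
have := subsetP sGSr v vG; rewrite !inE.
by case: eqP vG => // ->; rewrite (negPf uG).
Qed.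

Lemma mem_GrpCandidateSet (order : seq U) G :
  perm_eq order (enum U) ->
  G \in GrpCandidateSet I order <-> feasible I G.
Proof.
move=> order_workers; split=> [|feasG]; first exact: explore_feasible.
apply: feasible_explore feasG _ _; first exact: sub0set.
(* At the root, [order] lists every worker, so any group lies below it. *)
by apply/subsetP=> u _; rewrite !inE (perm_mem order_workers) mem_enum.
Qed.

End Exploration.

Theorem theorem4 (R : realFieldType) (U : finType) (m : nat)
    (I : grp_instance R U m) (order : seq U)
    (order_workers : perm_eq order (enum U))
    (has_feasible : exists G : {set U}, feasible I G) :
  (exists G : {set U}, OptGrp_returns I order G) /\
  (forall G : {set U}, OptGrp_returns I order G -> optimal I G).
Proof.
have candP G := mem_GrpCandidateSet I G order_workers.
split=> [|G [/candP feasG minG]]; last by split=> // H /candP; apply: minG.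
have [G0 /candP candG0] := has_feasible.
(* The candidates form a nonempty subset of the finite type [{set U}], as [G0] witnesses, so the
   diameter attains its minimum on them. *)
have [G candG minG] := @arg_minP _ _ _ G0 (mem (GrpCandidateSet I order)) (DiaDist I) candG0.
by exists G.
Qed.
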